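(* Let $T$ be a tree with $n$ vertices and maximum independent set size $\alpha$, and let $i_k$ denote the number of independent sets of size $k$ in $T$. Then every maximal (by inclusion) independent set in $T$ has size at least $\left\lceil \frac{n-\alpha+1}{2}\right\rceil$, and consequently the sequence $(i_0,i_1,\ldots,i_\ell)$ is non-decreasing, where $$\ell=\left\lceil \left\lceil \frac{n-\alpha+1}{2}\right\rceil/2\right\rceil=\left\lceil \frac{n-\alpha+1}{4}\right\rceil .$$
   Context: An independent set in a graph is a set of mutually non-adjacent vertices. *)

(* Defs.v *)
From mathcomp Require Import all_boot all_order all_algebra.
Set Implicit Arguments.
Unset Strict Implicit.
Unset Printing Implicit Defensive.

(* A finite simple graph with vertex set [T] is a symmetric irreflexive
   adjacency relation [e : rel T]. *)
Definition simple_graph (T : finType) (e : rel T) : Prop :=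
  symmetric e /\ irreflexive e.

(* Graph cycles are duplicate-free closed walks on at least three vertices:
   without the size bound, any edge x -- y would give the [ucycle] [:: x; y]. *)
Definition acyclic (T : finType) (e : rel T) : Prop :=
  forall c : seq T, ucycle e c -> size c <= 2.

(* The empty graph is not connected. *)
Definition connected (T : finType) (e : rel T) : Prop :=
  0 < #|T| /\ forall x y : T, connect e x y.

Definition tree (T : finType) (e : rel T) : Prop :=
  [/\ simple_graph e, connected e & acyclic e].

Definition independent (T : finType) (e : rel T) (S : {set T}) : bool :=
  [forall x in S, forall y in S, ~~ e x y].

Definition independence_number (T : finType) (e : rel T) : nat :=
  \max_(S : {set T} | independent e S) #|S|.

Definition num_independent (T : finType) (e : rel T) (k : nat) : nat :=
  #|[set S : {set T} | independent e S & #|S| == k]|.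

(* Main.v *)
(** Root the tree at a vertex [r] of a maximal independent set [S]; every edge
    joins a vertex to its parent.  Let [A] be the set of vertices outside [S]
    whose parent is also outside [S].  The complement of [S] without [A] is
    independent.  By maximality of [S] each vertex of [A] has a neighbour in
    [S], necessarily a child, so taking parents maps [S] minus [r] onto a
    superset of [A].  Hence [n - #|S| - (#|S| - 1) <= alpha].

    If all maximal independent sets have size at least [m], an independent set
    of size [k] has at least [m - k] independent extensions of size [k + 1],
    and each of those contains only [k + 1] sets of size [k]; double counting
    gives [i_k <= i_(k+1)] as long as [k + 1 <= m - k]. *)
Require Import Defs.
From mathcomp Require Import all_boot all_order all_algebra.
From mathcomp Require Import zify lra.
Set Implicit Arguments.
Unset Strict Implicit.
Unset Printing Implicit Defensive.
Import Order.TTheory GRing.Theory Num.Theory.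
Local Open Scope ring_scope.

Section IndependentSets.
Local Open Scope nat_scope.
Variables (T : finType) (e : rel T).

Lemma independentP (S : {set T}) :
  reflect {in S &, forall x y, ~~ e x y} (independent e S).
Proof.
apply: (iffP forall_inP) => [H x y xS yS|H x xS].
  by move/forall_inP: (H x xS) => /(_ y yS).
by apply/forall_inP => y yS; apply: H.
Qed.

Lemma independentS (A B : {set T}) :
  A \subset B -> independent e B -> independent e A.
Proof.
move=> /subsetP sAB /independentP indB; apply/independentP => x y xA yA.
by apply: indB; apply: sAB.
Qed.

Lemma leq_independence_number (S : {set T}) :
  independent e S -> #|S| <= independence_number e.
Proof. exact: leq_bigmax_cond. Qed.

Lemma maxset_independent_dominates (S : {set T}) (v : T) :
  simple_graph e -> maxset (independent e) S -> v \notin S ->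
  exists2 s, s \in S & e v s.
Proof.
move=> [sym irr] /maxsetP[/independentP indS maxS] vS.
apply/exists_inP; apply: contraT => /exists_inPn noedge.
rewrite -(negbTE vS) -(maxS (v |: S)) ?setU11 ?subsetU1 //.
apply/independentP => x y /setU1P[->|xS] /setU1P[->|yS].
- by rewrite irr.
- exact: noedge.
- by rewrite sym; apply: noedge.
- exact: indS.
Qed.

Section DoubleCounting.
Variable m : nat.
Hypothesis m_max : forall S : {set T}, maxset (independent e) S -> m <= #|S|.

Let indep k := [set S : {set T} | independent e S & #|S| == k].

(** A maximal independent set [M] above [S] has at least [m - k] vertices outside [S], and adding
    each one to [S] gives a different extension. *)
Lemma independent_extensions (k : nat) (S : {set T}) : S \in indep k ->
  m - k <= #|[set U in indep k.+1 | S \subset U]|.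
Proof.
rewrite inE => /andP[indS /eqP cardS].
have [M maxM sSM] := maxset_exists indS.
have injU : {in M :\: S &, injective (fun x => x |: S)}.
  move=> x y /setDP[_ xS] _ /= eqxy.
  have : x \in y |: S by rewrite -eqxy setU11.
  by case/setU1P => // xS'; rewrite xS' in xS.
apply: (@leq_trans #|M :\: S|).
  by rewrite cardsDS // cardS leq_sub2r // m_max.
rewrite -(card_in_imset injU); apply/subset_leq_card/subsetP.
move=> _ /imsetP[x /setDP[xM xS] ->]; rewrite !inE subsetU1 andbT cardsU1 xS.
rewrite cardS eqxx andbT; apply: independentS (maxsetp maxM).
by apply/subsetP => y /setU1P[->//|]; apply: (subsetP sSM).
Qed.

Lemma independent_restrictions (k : nat) (U : {set T}) : U \in indep k.+1 ->
  #|[set S in indep k | S \subset U]| <= k.+1.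
Proof.
rewrite inE => /andP[_ /eqP cardU].
rewrite -[leqRHS](binSn k) -cardU -cards_draws.
apply/subset_leq_card/subsetP => S.
by rewrite !inE => /andP[/andP[_ ->] ->].
Qed.

Lemma num_independent_leS (k : nat) : k.*2.+1 <= m ->
  num_independent e k <= num_independent e k.+1.
Proof.
move=> lekm; rewrite -(leq_pmul2r (ltn0Sn k)).
apply: (@leq_trans (\sum_(S in indep k) \sum_(U in indep k.+1 | S \subset U) 1)).
  rewrite -sum_nat_const; apply: leq_sum => S Sk.
  rewrite sum1dep_card; apply: leq_trans (independent_extensions Sk).
  by lia.
rewrite (exchange_big_dep (mem (indep k.+1))) /=; last by move=> S U _ /andP[].
rewrite -sum_nat_const; apply: leq_sum => U Uk.
apply: leq_trans (independent_restrictions Uk); rewrite sum1dep_card.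
by apply/subset_leq_card/subsetP => S; rewrite !inE => /and3P[-> _ ->].
Qed.

(** The last step climbs from [k - 1] to [k] and needs [2(k - 1) + 1 <= m]; hence the bound
    [m.+1]. *)
Lemma num_independent_homo (j k : nat) : j <= k -> k.*2 <= m.+1 ->
  num_independent e j <= num_independent e k.
Proof.
elim: k => [|k IHk]; first by rewrite leqn0 => /eqP->.
rewrite leq_eqVlt => /predU1P[-> //|ltjk] lekm.
apply: leq_trans (num_independent_leS _); last by lia.
by apply: IHk => //; lia.
Qed.

End DoubleCounting.

Section RootedTree.
Hypothesis tree_e : tree e.
Variable r : T.

Let avoid (x : T) : rel T := [rel u v | [&& e u v, u != x & v != x]].

Let avoid_sub (x : T) : subrel (avoid x) e.
Proof. by move=> u v /and3P[]. Qed.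

(** The parent of [x] is its neighbour on the root side, the one still reachable from [r] once [x]
    is deleted. No path or depth has to be chosen. *)
Definition parent_rel : rel T :=
  [rel x y | [&& x != r, e x y & connect (avoid x) r y]].

Lemma avoid_path (x u : T) (p : seq T) :
  path e u p -> x \notin u :: p -> path (avoid x) u p.
Proof.
elim: p u => //= v p IHp u /andP[euv pathp].
rewrite !inE !negb_or => /and3P[xu xv xp].
by rewrite IHp ?inE ?negb_or ?xv // andbT /avoid /= euv !(eq_sym _ x) xu xv.
Qed.

(** Take a simple path from [r] to [x]. If it misses [y], then [x] is the parent of [y]; otherwise
    its part up to [y] avoids the endpoint [x], and [y] is the parent of [x]. *)
Lemma parent_rel_edge (x y : T) : e x y -> parent_rel x y || parent_rel y x.
Proof.
have [[sym irr] [_ conn] _] := tree_e.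
move=> exy; have nxy : x != y by apply: contraTneq exy => ->; rewrite irr.
have /connectP[p0 path0 lastx] := conn r x.
case: (shortenP path0) lastx => p pathp uniqp _ lastx.
have [yp|yp] := boolP (y \in r :: p); last first.
  apply/orP; right; rewrite /parent_rel /= (sym y) exy /=.
  move: (yp); rewrite inE negb_or => /andP[-> _] /=.
  by apply/connectP; exists p => //; apply: avoid_path.
apply/orP; left; rewrite /parent_rel /= exy /=.
case/splitPl: yp pathp uniqp lastx => p1 p2 last1.
rewrite cat_path last_cat last1 -cat_cons cat_uniq.
case/andP=> path1 _ /and3P[_ /hasPn disj _] lastx.
have x1 : x \notin r :: p1.
  apply: disj; rewrite lastx; case: (p2) lastx => [/= xy|z q _] /=.
    by rewrite xy eqxx in nxy.
  exact: mem_last.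
move: (x1); rewrite inE negb_or => /andP[-> _] /=.
by apply/connectP; exists p1 => //; apply: avoid_path.
Qed.

(** Two distinct parents would be joined by a simple path avoiding [x]; closing it through [x] gives
    a cycle on at least three vertices. *)
Lemma parent_rel_inj (x y z : T) : parent_rel x y -> parent_rel x z -> y = z.
Proof.
have [[sym irr] _ acyc] := tree_e.
case/and3P=> _ exy ry /and3P[_ exz rz]; apply/eqP; apply: contraT => nyz.
have symx : connect_sym (avoid x).
  by apply: sym_connect_sym => u v; rewrite /avoid /= sym (andbC (u != x)).
have : connect (avoid x) y z by apply: connect_trans rz; rewrite symx.
case/connectP=> p0 path0; case: (shortenP path0) => p pathp uniqp _ lastz.
have xp : x \notin y :: p.
  have nxy : x != y by apply: contraTneq exy => ->; rewrite irr.
  rewrite inE negb_or nxy /=.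
  elim: (p) (y) pathp => //= v q IHq u /andP[/and3P[_ _ vx] /IHq xq].
  by rewrite inE negb_or eq_sym vx.
have : ucycle e (x :: y :: p).
  rewrite /ucycle /= rcons_path -lastz exy (sub_path (@avoid_sub x) pathp) /=.
  by rewrite sym exz /= -[x \notin _]/(x \notin y :: p) xp.
move/acyc; case: (p) lastz => // zy _.
by rewrite zy eqxx in nyz.
Qed.

Lemma maxset_independent_root (S : {set T}) :
  maxset (independent e) S -> r \in S ->
  #|T| < independence_number e + #|S|.*2.
Proof.
move=> maxS rS; have [simple _ _] := tree_e; have [sym _] := simple.
pose A := [set v in ~: S | [exists u in ~: S, parent_rel v u]].
pose B := ~: S :\: A.
(* An edge inside [B] joins a child to a parent outside [S], which puts the child in [A]. *)
have indB : independent e B.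
  apply/independentP => x y; rewrite !inE => /andP[xA xS] /andP[yA yS].
  apply: contraNN xA => /parent_rel_edge/orP[] par; rewrite xS /=.
    by apply/exists_inP; exists y; rewrite ?inE.
  by case/negP: yA; rewrite yS; apply/exists_inP; exists x; rewrite ?inE.
pose f x := odflt x [pick y | parent_rel x y].
have fE x y : parent_rel x y -> f x = y.
  rewrite /f; case: pickP => [z /= xz xy|/(_ y) /= -> //].
  exact: parent_rel_inj xz xy.
have cardA : #|A| < #|S|.
  (* Discarding [r], which has no parent, makes the inequality strict. *)
  rewrite [leqRHS](cardsD1 r) rS ltnS.
  apply: leq_trans (leq_imset_card f _).
  apply/subset_leq_card/subsetP => v.
  rewrite inE in_setC => /andP[vS /exists_inP[u]]; rewrite in_setC => uS vu.
  have [s sS evs] := maxset_independent_dominates simple maxS vS.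
  (* Were [s] the parent of [v], uniqueness would give [u = s], but [u] is outside [S]. *)
  have sv : parent_rel s v.
    case/orP: (parent_rel_edge evs) => // vs.
    by rewrite (parent_rel_inj vu vs) sS in uS.
  apply/imsetP; exists s; last by rewrite (fE s v).
  by rewrite !inE sS andbT; case/and3P: sv.
have sAS : A \subset ~: S by apply/subsetP => v; rewrite inE => /andP[].
have := leq_independence_number indB; rewrite cardsDS //.
by have := cardsC S; lia.
Qed.

End RootedTree.

(** A root in [S] exists: any vertex outside [S] has a neighbour in [S]. *)
Lemma maxset_independent_lower_bound (S : {set T}) :
  tree e -> maxset (independent e) S -> #|T| < independence_number e + #|S|.*2.
Proof.
move=> tree_e maxS; have [simple [/card_gt0P[v _] _] _] := tree_e.
have [vS|vS] := boolP (v \in S).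
  exact: (maxset_independent_root tree_e maxS vS).
have [s sS _] := maxset_independent_dominates simple maxS vS.
exact: (maxset_independent_root tree_e maxS sS).
Qed.

End IndependentSets.

(** Both sides have the same integer upper bounds [z], namely those with [x <= 2z]. *)
Lemma ceil_half_ceil (R : archiRealFieldType) (x : R) :
  Num.ceil ((Num.ceil x)%:~R / 2 : R) = Num.ceil (x / 2).
Proof.
have ceilE (z : int) :
    (Num.ceil ((Num.ceil x)%:~R / 2 : R) <= z) = (Num.ceil (x / 2) <= z).
  rewrite !ceil_le_int !ler_pdivrMr ?ltr0n //.
  by rewrite -[2]/(2%:~R) -intrM ler_int ceil_le_int.
by apply/eqP; rewrite eq_le ceilE lexx -ceilE lexx.
Qed.

Theorem theorem1p6 (T : finType) (e : rel T) (tree_e : tree e) :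
  let n : rat := #|T|%:R in
  let alpha : rat := (independence_number e)%:R in
  let m : int := Num.ceil ((n - alpha + 1) / 2) in
  let l : int := Num.ceil (m%:~R / 2 : rat) in
  [/\ forall S : {set T}, maxset (independent e) S -> m <= #|S|%:Z,
      l = Num.ceil ((n - alpha + 1) / 4)
    & forall j k : nat, (j <= k)%N -> k%:Z <= l ->
        (num_independent e j <= num_independent e k)%N].
Proof.
move=> n alpha m l.
have lem S : maxset (independent e) S -> m <= #|S|%:Z.
  move=> /(maxset_independent_lower_bound tree_e).
  rewrite /m ceil_le_int ler_pdivrMr ?ltr0n // -(ler_nat rat) -addnn !natrD.
  by rewrite -natr1 -[(_%:Z)%:~R]/(#|S|%:R : rat) /n /alpha; lra.
split=> // [|j k lejk lekl].
  by rewrite /l ceil_half_ceil; congr Num.ceil; lra.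
apply: (@num_independent_homo _ _ `|Num.max m 0|%N) => // [S /lem|]; first by lia.
(* From [k - 1 < l] follows [k - 1 < m / 2], that is [2k <= m + 1] over the integers. *)
have : k%:Z - 1 < l by lia.
by rewrite ceil_gt_int ltr_pdivlMr ?ltr0n // -[2]/(2%:~R) -intrM ltr_int; lia.
Qed.
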